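(* Let $c_0,c_1,c_2,\ldots$ be an infinite sequence of elements of $Z$ with $c_j\in Z^*$ for all $j\ge 1$. Then the sequence of convergents $\frac{s_n}{t_n}=[c_0;c_1,\dots,c_n]$ converges to an element $\alpha$ of $K$. Moreover, for every $n\ge 0$, $$\left|\alpha-\frac{s_n}{t_n}\right|=\frac{1}{|t_n|\,|t_{n+1}|}.$$
   Context: Let $p$ be a prime and let $K$ be a finite extension of $\mathbb{Q}_p$ of degree $m$, with ramification index $e$ and residue degree $f$ (so $m=ef$). Let $|\cdot|$ be the unique extension to $K$ of the $p$-adic absolute value with $|p|=p^{-1}$. Let $L\subseteq K$ be the unramified subextension of degree $f$ over $\mathbb{Q}_p$, write $L=\mathbb{Q}_p(\gamma)$ with $\gamma$ a primitive $(p^f-1)$-th root of unity, and fix $\beta\in K$ with $K=L(\beta)$ and $|\beta|=p^{1/e}$. Let $D$ be either $\{0,1,\dots,p-1\}$ or (for $p$ odd) $\{-\frac{p-1}{2},\dots,\frac{p-1}{2}\}$; the claim is made for each choice. Let $X=\{\sum_{j=0}^{k}a_jp^{-j} : k\in\mathbb{N}\cup\{0\},\ a_j\in D\}$, $Z=\{\sum_{i=0}^{e-1}\sum_{j=0}^{f-1}b_{i,j}\gamma^j\beta^i : b_{i,j}\in X\}$, and $Z^*=\{c\in Z : |c|>1\}$. Here $[c_0;c_1,\dots,c_n]=c_0+\cfrac{1}{c_1+\cfrac{1}{\ddots+\cfrac{1}{c_n}}}$. The sequences $(s_n)$ and $(t_n)$ are defined by $s_0=c_0$, $t_0=1$, $s_1=c_0c_1+1$,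 $t_1=c_1$, and $s_n=c_ns_{n-1}+s_{n-2}$, $t_n=c_nt_{n-1}+t_{n-2}$ for $n\ge 2$. *)

(* Defs.v *)
From HB Require Import structures.
From mathcomp Require Import all_boot all_order all_algebra all_field.
From mathcomp Require Import ring_quotient.
From mathcomp Require Import boolp classical_sets functions reals topology
  normedtype sequences exp.
From mathcomp Require Import ring lra.

Set Implicit Arguments.
Unset Strict Implicit.
Unset Printing Implicit Defensive.

Import Order.TTheory GRing.Theory Num.Theory.
Import numFieldNormedType.Exports.

Local Open Scope ring_scope.

(* For p not prime, logn p is 0 and this is the trivial absolute value, so
   that the constructions below make sense for every p. *)
Definition padic_abs (p : nat) (x : rat) : rat :=
  if x == 0 then 0
  else p%:Q ^ ((logn p `|denq x|)%:Z - (logn p `|numq x|)%:Z).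

Section PadicAbs.
Variable p : nat.
Local Notation abs := (padic_abs p).

Let q : rat := (if prime p then p else 1%N)%:R.

Let q_gt0 : 0 < q.
Proof. by rewrite /q; case: ifP => // /prime_gt0; rewrite ltr0n. Qed.

Let q_ge1 : 1 <= q.
Proof. by rewrite /q; case: ifP => // /prime_gt0; rewrite ler1n. Qed.

Let qE (m : nat) (n : nat) :
  p%:Q ^ ((logn p m)%:Z - (logn p n)%:Z) = q ^+ logn p m / q ^+ logn p n.
Proof.
rewrite /q; case: ifPn => pp.
  by rewrite expfzDr ?pnatr_eq0 -?lt0n ?prime_gt0 // exprnP -exprnN.
have log0 k : logn p k = 0%N by rewrite lognE (negPf pp).
by rewrite !log0 subrr expr0z divr1.
Qed.

Let absZ (m : int) : rat := if m == 0 then 0 else (q ^+ logn p `|m|)^-1.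

Let absZ_ge0 m : 0 <= absZ m.
Proof. by rewrite /absZ; case: ifP => // _; rewrite invr_ge0 exprn_ge0 // ltW. Qed.

Let absZ_gt0 m : m != 0 -> 0 < absZ m.
Proof. by rewrite /absZ => /negPf->; rewrite invr_gt0 exprn_gt0. Qed.

Let absZM m n : absZ (m * n) = absZ m * absZ n.
Proof.
rewrite /absZ mulf_eq0; have [m0|m0] /= := eqVneq m 0; first by rewrite mul0r.
have [n0|n0] /= := eqVneq n 0; first by rewrite mulr0.
by rewrite abszM lognM ?absz_gt0 // exprD invfM.
Qed.

Let absZD m n : absZ (m + n) <= Num.max (absZ m) (absZ n).
Proof.
have [->|m0] := eqVneq m 0; first by rewrite add0r le_max lexx orbT.
have [->|n0] := eqVneq n 0; first by rewrite addr0 le_max lexx.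
have [->|s0] := eqVneq (m + n) 0.
  by rewrite {1}/absZ eqxx le_max absZ_ge0.
rewrite /absZ (negPf m0) (negPf n0) (negPf s0).
have qX k l : ((q ^+ k)^-1 <= (q ^+ l)^-1) = (q ^+ l <= q ^+ k).
  by rewrite lef_pV2 // posrE exprn_gt0.
rewrite le_max !qX.
case pp : (prime p); last by rewrite /q pp !expr1n lexx.
wlog le_mn : m n m0 n0 s0 / (logn p `|m| <= logn p `|n|)%N.
  move=> H; case/orP: (leq_total (logn p `|m|) (logn p `|n|)) => le.
    exact: H.
  by rewrite addrC orbC; apply: H => //; rewrite addrC.
apply/orP; left; rewrite ler_weXn2l //.
rewrite -pfactor_dvdn ?absz_gt0 //.
have : ((p ^ logn p `|m|)%N%:Z %| m + n)%Z.
  by rewrite rpredD // dvdzE /= ?pfactor_dvdnn // pfactor_dvdn ?absz_gt0.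
by rewrite dvdzE.
Qed.

Let absE (a b : int) : b != 0 -> abs (a%:~R / b%:~R) = absZ a / absZ b.
Proof.
move=> b0; have b0' : b%:~R != 0 :> rat by rewrite intr_eq0.
rewrite /padic_abs; have [/eqP|x0] := eqVneq (a%:~R / b%:~R) (0 : rat).
  rewrite mulf_eq0 invr_eq0 (negPf b0') orbF intr_eq0 => /eqP->.
  by rewrite {1}/absZ eqxx mul0r.
set x := a%:~R / b%:~R in x0 *.
have nx0 : numq x != 0 by rewrite numq_eq0.
have dx0 := denq_neq0 x.
rewrite qE; have -> : q ^+ logn p `|denq x| / q ^+ logn p `|numq x| =
    absZ (numq x) / absZ (denq x).
  by rewrite /absZ (negPf nx0) (negPf dx0) invrK mulrC.
apply/eqP; rewrite eqr_div ?(gt_eqF (absZ_gt0 _)) //.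
rewrite -!absZM; apply/eqP; congr absZ; apply/eqP; rewrite -(eqr_int rat) !intrM.
by rewrite -eqr_div ?intr_eq0 // divq_num_den.
Qed.

Lemma padic_abs0 : abs 0 = 0. Proof. by rewrite /padic_abs eqxx. Qed.

Lemma padic_abs1 : abs 1 = 1.
Proof. by rewrite /padic_abs oner_eq0 /= !logn1 subrr expr0z. Qed.

Lemma padic_absM x y : abs (x * y) = abs x * abs y.
Proof.
rewrite -(divq_num_den x) -(divq_num_den y) mulf_div -!intrM.
rewrite !absE ?mulf_neq0 ?denq_neq0 // !absZM.
by rewrite mulf_div.
Qed.

Lemma padic_abs_ge0 x : 0 <= abs x.
Proof. by rewrite -(divq_num_den x) absE ?denq_neq0 // divr_ge0. Qed.

Lemma padic_abs_eq0 x : (abs x == 0) = (x == 0).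
Proof.
have [->|x0] := eqVneq x 0; first by rewrite padic_abs0 eqxx.
apply/negP => /eqP h; have : abs (x / x) = 1 by rewrite divff // padic_abs1.
by rewrite padic_absM h mul0r => /esym/eqP; rewrite oner_eq0.
Qed.

Lemma padic_absN x : abs (- x) = abs x.
Proof.
rewrite -mulN1r padic_absM; suff -> : abs (-1) = 1 by rewrite mul1r.
by rewrite /padic_abs oppr_eq0 oner_eq0 /= !logn1 subrr expr0z.
Qed.

Lemma padic_absD x y : abs (x + y) <= Num.max (abs x) (abs y).
Proof.
rewrite -(divq_num_den x) -(divq_num_den y).
have dx0 := denq_neq0 x; have dy0 := denq_neq0 y.
rewrite addf_div ?intr_eq0 // -!intrM -intrD.
rewrite !absE ?mulf_neq0 // ler_pdivrMr ?absZ_gt0 ?mulf_neq0 //.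
apply: le_trans (absZD _ _) _; rewrite !absZM maxr_pMl ?mulr_ge0 //.
apply: le_max2.
  by rewrite mulrA divfK // gt_eqF ?absZ_gt0.
by rewrite [absZ (denq x) * _]mulrC mulrA divfK // gt_eqF ?absZ_gt0.
Qed.

Lemma padic_absV x : abs x^-1 = (abs x)^-1.
Proof.
have [->|x0] := eqVneq x 0; first by rewrite !(invr0, padic_abs0).
have ax0 : abs x != 0 by rewrite padic_abs_eq0.
by apply: (mulfI ax0); rewrite -padic_absM !divff // padic_abs1.
Qed.

End PadicAbs.

Definition padic_cauchy (p : nat) : {pred nat -> rat} := fun u =>
  `[< forall eps : rat, 0 < eps -> exists N : nat, forall m n : nat,
        (N <= m)%N -> (N <= n)%N -> padic_abs p (u m - u n) < eps >].

Section CauchyRing.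
Variable p : nat.
Local Notation abs := (padic_abs p).

Lemma padic_cauchy_bounded u : u \in padic_cauchy p ->
  exists N : nat, exists2 M : rat, 0 < M &
    forall n, (N <= n)%N -> abs (u n) < M.
Proof.
move=> /asboolP /(_ 1 ltr01)[N HN].
exists N, (1 + abs (u N)) => [|n Nn].
  by rewrite ltr_pwDl // padic_abs_ge0.
rewrite -[u n](subrK (u N)); apply: le_lt_trans (padic_absD _ _ _) _.
rewrite gt_max ltr_wpDr ?padic_abs_ge0 ?HN //=.
by rewrite ltrDr.
Qed.

Lemma padic_cauchy_subring : subring_closed (padic_cauchy p).
Proof.
split=> [|u v /asboolP cu /asboolP cv|u v cu cv]; apply/asboolP => eps e0.
- by exists 0%N => m n _ _; rewrite subrr padic_abs0.
- have [N HN] := cu _ e0; have [M HM] := cv _ e0.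
  exists (maxn N M) => m n; rewrite !geq_max => /andP[Nm Mm] /andP[Nn Mn].
  have E k : (u - v) k = u k - v k by [].
  rewrite !E (_ : _ - _ = (u m - u n) + - (v m - v n)); last by ring.
  apply: le_lt_trans (padic_absD _ _ _) _.
  by rewrite gt_max padic_absN HN ?HM.
- have [N1 [A A0 HA]] := padic_cauchy_bounded cu.
  have [N2 [B B0 HB]] := padic_cauchy_bounded cv.
  move/asboolP: cu => cu; move/asboolP: cv => cv.
  have [N HN] := cu _ (divr_gt0 e0 B0); have [M HM] := cv _ (divr_gt0 e0 A0).
  exists (maxn (maxn N1 N2) (maxn N M)) => m n.
  rewrite !geq_max => /andP[/andP[m1 m2] /andP[m3 m4]].
  move=> /andP[/andP[n1 n2] /andP[n3 n4]].
  have E k : (u * v) k = u k * v k by [].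
  rewrite !E (_ : _ - _ = (u m - u n) * v m + u n * (v m - v n)); last by ring.
  apply: le_lt_trans (padic_absD _ _ _) _; rewrite gt_max !padic_absM.
  apply/andP; split.
    apply: le_lt_trans (_ : abs (u m - u n) * B < _).
      by rewrite ler_wpM2l ?padic_abs_ge0 // ltW ?HB.
    by rewrite -ltr_pdivlMr // HN.
  apply: le_lt_trans (_ : A * abs (v m - v n) < _).
    by rewrite ler_wpM2r ?padic_abs_ge0 // ltW ?HA.
  by rewrite mulrC -ltr_pdivlMr // HM.
Qed.

HB.instance Definition _ :=
  GRing.isSubringClosed.Build _ (padic_cauchy p) padic_cauchy_subring.

End CauchyRing.

Record cauchy_seq (p : nat) := CauchySeq {
  cseq :> nat -> rat;
  _ : cseq \in padic_cauchy p
}.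

HB.instance Definition _ p := [isSub for @cseq p].
HB.instance Definition _ p := [Choice of cauchy_seq p by <:].
HB.instance Definition _ p := [SubChoice_isSubComNzRing of cauchy_seq p by <:].

Definition padic_null (p : nat) : {pred cauchy_seq p} := fun u =>
  `[< forall eps : rat, 0 < eps -> exists N : nat, forall n : nat,
        (N <= n)%N -> padic_abs p (u n) < eps >].

Section NullIdeal.
Variable p : nat.
Local Notation abs := (padic_abs p).

Lemma padic_null_ideal : idealr_closed (@padic_null p).
Proof.
split=> [||a u v /asboolP nu /asboolP nv].
- by apply/asboolP => eps e0; exists 0%N => n _; rewrite padic_abs0.
- apply/negP => /asboolP /(_ 1 ltr01)[N /(_ N (leqnn N))].
  by rewrite padic_abs1 ltxx.
have [N [M M0 HM]] := padic_cauchy_bounded (valP a).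
apply/asboolP => eps e0.
have [Nu Hu] := nu _ (divr_gt0 e0 M0); have [Nv Hv] := nv _ e0.
exists (maxn N (maxn Nu Nv)) => n.
rewrite !geq_max => /andP[Nn /andP[un vn]].
rewrite -[(_ + _ : cauchy_seq p) n]/(a n * u n + v n).
apply: le_lt_trans (padic_absD _ _ _) _; rewrite gt_max Hv // andbT padic_absM.
apply: le_lt_trans (_ : M * abs (u n) < _).
  by rewrite ler_wpM2r ?padic_abs_ge0 // ltW ?HM.
by rewrite mulrC -ltr_pdivlMr // Hu.
Qed.

HB.instance Definition _ :=
  isIdealr.Build _ (@padic_null p) padic_null_ideal.

End NullIdeal.

Definition Qp (p : nat) : Type := {ideal_quot (@padic_null p)}.

HB.instance Definition _ p := GRing.ComNzRing.on (Qp p).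
HB.instance Definition _ p := EqQuotient.on (Qp p).

Section QpField.
Variable p : nat.
Local Notation abs := (padic_abs p).

Lemma padic_nonnull (u : cauchy_seq p) : u \notin @padic_null p ->
  exists N : nat, exists2 d : rat, 0 < d &
    forall n, (N <= n)%N -> d <= abs (u n).
Proof.
move=> /asboolPn nu; apply: contrapT => H; apply: nu => eps e0.
have /asboolP cu := valP u; have [N HN] := cu _ e0.
have [n Nn un] : exists2 n, (N <= n)%N & abs (u n) < eps.
  apply: contrapT => H'; apply: H; exists N, eps => // n Nn.
  by rewrite leNgt; apply/negP => un; apply: H'; exists n.
exists N => m Nm; rewrite -[u m](subrK (u n)).
by apply: le_lt_trans (padic_absD _ _ _) _; rewrite gt_max un HN.
Qed.

Definition cauchy_inv (u : cauchy_seq p) : nat -> rat :=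
  if u \in @padic_null p then 0 else fun n => (u n)^-1.

Lemma cauchy_inv_subproof u : cauchy_inv u \in padic_cauchy p.
Proof.
rewrite /cauchy_inv; case: ifPn => [_|nu]; first exact: rpred0.
have [N [d d0 Hd]] := padic_nonnull nu; apply/asboolP => eps e0.
have /asboolP cu := valP u.
have [M HM] := cu _ (mulr_gt0 e0 (mulr_gt0 d0 d0)).
exists (maxn N M) => m n; rewrite !geq_max => /andP[Nm Mm] /andP[Nn Mn].
have Hm := Hd _ Nm; have Hn := Hd _ Nn.
have am := lt_le_trans d0 Hm; have an := lt_le_trans d0 Hn.
have um : u m != 0 by rewrite -(padic_abs_eq0 p) gt_eqF.
have un : u n != 0 by rewrite -(padic_abs_eq0 p) gt_eqF.
have -> : (u m)^-1 - (u n)^-1 = (u n - u m) / (u m * u n).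
  by field; rewrite um un.
rewrite padic_absM padic_absV padic_absM ltr_pdivrMr ?mulr_gt0 //.
apply: lt_le_trans (HM _ _ Mn Mm) _.
by rewrite ler_wpM2l ?(ltW e0) // ler_pM // ltW.
Qed.

Definition Qp_inv (x : Qp p) : Qp p :=
  \pi_(Qp p)%qT (CauchySeq (cauchy_inv_subproof (repr x))).

Lemma Qp_eq0 (u : cauchy_seq p) :
  (\pi_(Qp p)%qT u == 0) = (u \in @padic_null p).
Proof.
by rewrite -[u in RHS]subr0 Quotient.idealrBE; congr (_ == _); rewrite !piE.
Qed.

Lemma Qp_mulVf (x : Qp p) : x != 0 -> Qp_inv x * x = 1.
Proof.
rewrite -{1}[x]reprK Qp_eq0 => nu; rewrite -{2}[x]reprK /Qp_inv.
set u := repr x in nu *; set v := CauchySeq _.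
suff /eqP : \pi_(Qp p)%qT (v * u) == \pi_(Qp p)%qT 1 by rewrite !piE.
rewrite -Quotient.idealrBE.
have [N [d d0 Hd]] := padic_nonnull nu.
apply/asboolP => eps e0; exists N => n Nn.
have un : u n != 0.
  by rewrite -(padic_abs_eq0 p) gt_eqF // (lt_le_trans d0) ?Hd.
rewrite -[(_ - _ : cauchy_seq p) n]/(cauchy_inv u n * u n - 1).
by rewrite /cauchy_inv (negPf nu) mulVf // subrr padic_abs0.
Qed.

Lemma Qp_inv0 : Qp_inv 0 = 0.
Proof.
apply/eqP; rewrite Qp_eq0; apply/asboolP => eps e0; exists 0%N => n _ /=.
by rewrite /cauchy_inv -Qp_eq0 reprK eqxx padic_abs0.
Qed.

HB.instance Definition _ :=
  GRing.ComNzRing_isField.Build (Qp p) Qp_mulVf Qp_inv0.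

End QpField.

Local Open Scope classical_set_scope.

(* The limit exists and does not depend on the representative: the absolute
   values of a Cauchy sequence form a Cauchy sequence of reals, and a null
   perturbation does not change their limit. *)
Definition Qp_abs (R : realType) (p : nat) (x : Qp p) : R :=
  lim ((fun n : nat => ratr (padic_abs p ((repr x : cauchy_seq p) n)) : R)
         @ \oo).

Record is_absval (R : realType) (F : fieldType) (abs : F -> R) : Prop :=
  IsAbsval {
    absval_ge0 : forall x, 0 <= abs x;
    absval_eq0 : forall x, abs x = 0 <-> x = 0;
    absvalM : forall x y, abs (x * y) = abs x * abs y;
    absvalD : forall x y, abs (x + y) <= abs x + abs y
  }.

Section Extensions.
Variables (R : realType) (F : fieldType) (K : fieldExtType F) (abs : K -> R).

Definition value_group (U : {vspace K}) : set R :=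
  [set abs x | x in [set x : K | x \in U /\ x != 0]].

(* The value group of the base field has index e in that of U: the r i
   represent the cosets, each exactly once. *)
Definition ramification_index (U : {subfield K}) (e : nat) : Prop :=
  exists r : 'I_e -> R,
    (forall i, value_group U (r i)) /\
    (forall v, value_group U v -> exists! i, value_group 1%VS (v / r i)).

(* With O_F and O_U the valuation rings of F and U, the r i lie in O_U and
   their residue classes form a basis of the residue field of U over the
   residue field of F; a residue class is 0 iff its elements satisfy
   abs x < 1. *)
Definition residue_degree (U : {subfield K}) (f : nat) : Prop :=
  exists r : 'I_f -> K,
    [/\ forall i, r i \in U /\ abs (r i) <= 1,
        forall x, x \in U -> abs x <= 1 ->
          exists a : 'I_f -> F, (forall i, abs (a i)%:A <= 1) /\
            abs (x - \sum_(i < f) a i *: r i) < 1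
      & forall a : 'I_f -> F, (forall i, abs (a i)%:A <= 1) ->
          abs (\sum_(i < f) a i *: r i) < 1 -> forall i, abs (a i)%:A < 1].

(* Residue fields of p-adic fields are finite, hence perfect, so no
   separability condition is needed. *)
Definition unramified (U : {subfield K}) : Prop := ramification_index U 1.

End Extensions.

Definition std_digits (p : nat) : set int := [set a | 0 <= a < p%:Z].

Definition sym_digits (p : nat) : set int :=
  [set a | - (p.-1./2)%:Z <= a <= (p.-1./2)%:Z].

Section ContinuedFractions.
Variable K : fieldType.

Definition Xset (p : nat) (D : set int) : set K :=
  [set x | exists k : nat, exists a : 'I_k.+1 -> int,
     (forall j, D (a j)) /\ x = \sum_(j < k.+1) (a j)%:~R * p%:R ^- j].

Definition Zset (p e f : nat) (D : set int) (gamma beta : K) : set K :=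
  [set z | exists b : 'I_e -> 'I_f -> K,
     (forall i j, Xset p D (b i j)) /\
     z = \sum_(i < e) \sum_(j < f) b i j * gamma ^+ j * beta ^+ i].

Definition Zstar (R : realType) (abs : K -> R) (p e f : nat) (D : set int)
    (gamma beta : K) : set K :=
  [set z | Zset p e f D gamma beta z /\ 1 < abs z].

Fixpoint cfrac (c : nat -> K) (n : nat) : K :=
  if n is n'.+1 then c 0%N + (cfrac (fun j => c j.+1) n')^-1 else c 0%N.

Fixpoint cf_num (c : nat -> K) (n : nat) : K :=
  match n with
  | 0%N => c 0%N
  | n1.+1 => match n1 with
             | 0%N => c 0%N * c 1%N + 1
             | n2.+1 => c n * cf_num c n1 + cf_num c n2
             end
  end.

Fixpoint cf_den (c : nat -> K) (n : nat) : K :=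
  match n with
  | 0%N => 1
  | n1.+1 => match n1 with
             | 0%N => c 1%N
             | n2.+1 => c n * cf_den c n1 + cf_den c n2
             end
  end.

End ContinuedFractions.

(* Main.v *)
(** The c_j with j >= 1 have absolute value > 1, so the ultrametric
  inequality gives |t_n| = |c_1| ... |c_n|, and s_(n+1) t_n - s_n t_(n+1) = +-1
  gives |x_(n+1) - x_n| = 1 / (|t_n| |t_(n+1)|) for x_n = s_n / t_n.  The value
  group of Q_p has index e in that of K, hence |c_j| > 1 forces |c_j|^e >= 2,
  so these distances decrease strictly to 0: the convergents form a Cauchy
  sequence and, the first step dominating all later ones, the distance of the
  limit to x_n is |x_(n+1) - x_n|.  Completeness of K follows from that of Q_p
  by adding one basis vector at a time. *)
Require Import Defs.
From mathcomp Require Import all_boot all_order all_algebra all_field.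
From mathcomp Require Import ring_quotient.
From mathcomp Require Import boolp classical_sets functions reals topology
  normedtype sequences exp.
From mathcomp Require Import ring lra.

Set Implicit Arguments.
Unset Strict Implicit.
Unset Printing Implicit Defensive.

Import Order.TTheory GRing.Theory Num.Theory.
Import numFieldNormedType.Exports.

Local Open Scope classical_set_scope.
Local Open Scope ring_scope.

(** * Limits and Cauchy sequences in a field with an absolute value *)

Section ValuedField.
Variables (R : realType) (F : fieldType) (abs : F -> R).

Definition converges_to (u : nat -> F) (x : F) : Prop :=
  forall eps : R, 0 < eps ->
    exists N : nat, forall n : nat, (N <= n)%N -> abs (u n - x) < eps.

Definition cauchy_wrt (u : nat -> F) : Prop :=
  forall eps : R, 0 < eps -> exists N : nat, forall m n : nat,
    (N <= m)%N -> (N <= n)%N -> abs (u m - u n) < eps.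

Hypothesis absF : is_absval abs.

Lemma abs0 : abs 0 = 0.
Proof. exact/(absval_eq0 absF). Qed.

Lemma abs_eq0 x : (abs x == 0) = (x == 0).
Proof. by apply/eqP/eqP => /(absval_eq0 absF). Qed.

Lemma abs_gt0 x : (0 < abs x) = (x != 0).
Proof. by rewrite lt_neqAle absval_ge0 // andbT eq_sym abs_eq0. Qed.

Lemma abs1 : abs 1 = 1.
Proof.
have a1 : abs 1 != 0 by rewrite abs_eq0 oner_eq0.
by apply: (mulfI a1); rewrite -absvalM // !mulr1.
Qed.

Lemma absX x n : abs (x ^+ n) = abs x ^+ n.
Proof.
elim: n => [|n IH]; first by rewrite !expr0 abs1.
by rewrite !exprS absvalM // IH.
Qed.

Lemma absV x : abs x^-1 = (abs x)^-1.
Proof.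
have [->|x0] := eqVneq x 0; first by rewrite !(invr0, abs0).
have ax0 : abs x != 0 by rewrite abs_eq0.
by apply: (mulfI ax0); rewrite -absvalM // !divff // abs1.
Qed.

Lemma absN x : abs (- x) = abs x.
Proof.
rewrite -mulN1r absvalM //; suff -> : abs (-1) = 1 by rewrite mul1r.
apply/eqP; rewrite -(@eqrXn2 _ 2) ?absval_ge0 ?ler01 //.
by rewrite -absX sqrrN !expr1n abs1.
Qed.

Lemma abs_distC x y : abs (x - y) = abs (y - x).
Proof. by rewrite -absN opprB. Qed.

Lemma abs_sum (I : Type) (r : seq I) (P : pred I) (E : I -> F) :
  abs (\sum_(i <- r | P i) E i) <= \sum_(i <- r | P i) abs (E i).
Proof.
elim/big_rec2: _ => [|i y x _ le]; first by rewrite abs0.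
by apply: le_trans (absvalD absF _ _) _; rewrite lerD2l.
Qed.

Lemma converges_to_cauchy u x : converges_to u x -> cauchy_wrt u.
Proof.
move=> ux eps e0; have [N HN] := ux _ (divr_gt0 e0 (ltr0Sn R 1)).
exists N => m n Nm Nn.
rewrite (_ : u m - u n = (u m - x) + (x - u n)); last by ring.
apply: le_lt_trans (absvalD absF _ _) _; rewrite [eps]splitr ltrD ?HN //.
by rewrite abs_distC HN.
Qed.

Lemma converges_to_unique u x y : converges_to u x -> converges_to u y -> x = y.
Proof.
move=> ux uy; apply/eqP; rewrite -subr_eq0 -abs_eq0 eq_le absval_ge0 // andbT.
apply/ler_addgt0Pl => eps e0; rewrite addr0.
have [N HN] := ux _ (divr_gt0 e0 (ltr0Sn R 1)).
have [M HM] := uy _ (divr_gt0 e0 (ltr0Sn R 1)).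
rewrite (_ : x - y = (x - u (maxn N M)) + (u (maxn N M) - y)); last by ring.
apply: le_trans (absvalD absF _ _) _; rewrite [eps]splitr lerD // ltW //.
  by rewrite abs_distC HN // leq_maxl.
by rewrite HM // leq_maxr.
Qed.

Lemma converges_toD u v x y : converges_to u x -> converges_to v y ->
  converges_to (fun n => u n + v n) (x + y).
Proof.
move=> ux vy eps e0; have [N HN] := ux _ (divr_gt0 e0 (ltr0Sn R 1)).
have [M HM] := vy _ (divr_gt0 e0 (ltr0Sn R 1)).
exists (maxn N M) => n; rewrite geq_max => /andP[Nn Mn].
rewrite (_ : _ - _ = (u n - x) + (v n - y)); last by ring.
by apply: le_lt_trans (absvalD absF _ _) _; rewrite [eps]splitr ltrD ?HN ?HM.
Qed.

Lemma converges_toM u x w : converges_to u x ->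
  converges_to (fun n => u n * w) (x * w).
Proof.
have [->|w0] := eqVneq w 0.
  by move=> _ eps e0; exists 0%N => n _; rewrite !mulr0 subr0 abs0.
move=> ux eps e0; have [|N HN] := ux (eps / abs w).
  by rewrite divr_gt0 ?abs_gt0.
by exists N => n Nn; rewrite -mulrBl absvalM // -ltr_pdivlMr ?abs_gt0 ?HN.
Qed.

Lemma cauchyB u v : cauchy_wrt u -> cauchy_wrt v ->
  cauchy_wrt (fun n => u n - v n).
Proof.
move=> cu cv eps e0; have [N HN] := cu _ (divr_gt0 e0 (ltr0Sn R 1)).
have [M HM] := cv _ (divr_gt0 e0 (ltr0Sn R 1)).
exists (maxn N M) => m n; rewrite !geq_max => /andP[Nm Mm] /andP[Nn Mn].
rewrite (_ : _ - _ = (u m - u n) + (v n - v m)); last by ring.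
by apply: le_lt_trans (absvalD absF _ _) _; rewrite [eps]splitr ltrD ?HN ?HM.
Qed.

End ValuedField.

(** * Archimedean estimates on powers *)

Lemma invnS_lt (R : archiRealFieldType) (eps : R) : 0 < eps ->
  exists N : nat, forall n : nat, (N <= n)%N -> n.+1%:R^-1 < eps.
Proof.
move=> e0; exists (Num.truncn eps^-1) => n Nn.
rewrite invf_plt ?posrE ?ltr0n //.
by apply: lt_le_trans (truncnS_gt _) _; rewrite ler_nat.
Qed.

Lemma bernoulli_le (R : realDomainType) (r : R) (n : nat) :
  1 <= r -> 1 + n%:R * (r - 1) <= r ^+ n.
Proof.
move=> r1; elim: n => [|n IH]; first by rewrite mul0r addr0 expr0.
rewrite exprS -natr1; apply: le_trans (_ : r * (1 + n%:R * (r - 1)) <= _).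
  rewrite -subr_ge0 (_ : _ - _ = n%:R * (r - 1) ^+ 2); last by ring.
  by rewrite mulr_ge0 ?ler0n ?sqr_ge0.
by rewrite ler_wpM2l // (le_trans ler01).
Qed.

(** For [r > 1], Bernoulli's inequality gives powers of [r] a linearly growing lower bound, which
    passes any [M]. *)
Lemma bounded_expr_le1 (R : archiRealFieldType) (r M : R) :
  (forall n : nat, r ^+ n <= M) -> r <= 1.
Proof.
move=> H; rewrite leNgt; apply/negP => r1.
have d0 : 0 < r - 1 by rewrite subr_gt0.
have := H (Num.truncn (M / (r - 1))).+1; apply/negP; rewrite -ltNge.
apply: lt_le_trans (bernoulli_le _ (ltW r1)).
by rewrite ltr_wpDl // -ltr_pdivrMr // truncnS_gt.
Qed.

(* If r > 1 then r ^ (2 n) >= (1 + n (r - 1)) ^ 2 outgrows 2 n + 1. *)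
Lemma le1_expr_linear (R : archiRealFieldType) (r : R) :
  (forall n : nat, r ^+ n <= n.+1%:R) -> r <= 1.
Proof.
move=> H; rewrite leNgt; apply/negP => r1.
set d := r - 1; have d0 : 0 < d by rewrite subr_gt0.
(* This choice gives $n d^2 > 2$, hence $(1+nd)^2 > 1 + n(nd^2) > 1 + 2n$, against the hypothesis at
   exponent [n + n]. *)
pose n := (Num.truncn (2 / d ^+ 2)).+1.
have nd : 2 < n%:R * d ^+ 2 by rewrite -ltr_pdivrMr ?exprn_gt0 // truncnS_gt.
have n0 : 0 < n%:R :> R by rewrite ltr0n.
have := H (n + n)%N; rewrite exprD -natr1 natrD => H1.
have Bn := bernoulli_le n (ltW r1); set s := r ^+ n in H1 Bn.
have nd0 : 0 < n%:R * d by rewrite mulr_gt0.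
have : (1 + n%:R * d) * (1 + n%:R * d) <= s * s by rewrite ler_pM // addr_ge0 ?ltW.
have : n%:R * 2 < n%:R * (n%:R * d ^+ 2) by rewrite ltr_pM2l.
rewrite expr2; set x := n%:R in H1 n0 nd0 *; nra.
Qed.

(** * The ultrametric inequality *)

Section Ultrametric.
Variables (R : realType) (F : fieldType) (abs : F -> R).
Hypothesis absF : is_absval abs.
Hypothesis abs_nat : forall n : nat, abs n%:R <= 1.

(** [is_absval] grants only the triangle inequality. Binomial coefficients have absolute value at
    most 1, so expanding $(x+y)^n$ gives $|x+y|^n \le (n+1) M^n$ for all [n]; [le1_expr_linear]
    disposes of the linear factor. *)
Lemma abs_ultra x y : abs (x + y) <= Num.max (abs x) (abs y).
Proof.
set M := Num.max _ _.
have xM : abs x <= M by rewrite le_max lexx.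
have yM : abs y <= M by rewrite le_max lexx orbT.
have M0 : 0 <= M := le_trans (absval_ge0 absF x) xM.
have [ME|Mn] := eqVneq M 0.
  by rewrite ME (le_trans (absvalD absF _ _)) // -[0]addr0 -ME lerD.
have Mp : 0 < M by rewrite lt_neqAle eq_sym Mn.
rewrite -[M]mul1r -ler_pdivrMr //; apply: le1_expr_linear => n.
rewrite expr_div_n ler_pdivrMr ?exprn_gt0 // -absX // exprDn.
apply: le_trans (abs_sum absF _ _ _) _.
have -> : n.+1%:R * M ^+ n = \sum_(i < n.+1) M ^+ n.
  by rewrite sumr_const card_ord mulr_natl.
apply: ler_sum => i _; rewrite -mulr_natl absvalM // -[M ^+ n]mul1r.
apply: ler_pM; rewrite ?absval_ge0 // (absvalM absF) !(absX absF).
rewrite -[X in M ^+ X](subnK (leq_ord i)) exprD.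
apply: ler_pM; rewrite ?exprn_ge0 ?(absval_ge0 absF) //; apply: lerXn2r => //;
  exact: (absval_ge0 absF).
Qed.

(** Since $x = (x+y) - y$, [abs x] is at most the maximum of [abs (x + y)] and [abs y], and the
    second is excluded. *)
Lemma abs_ultra_lt x y : abs y < abs x -> abs (x + y) = abs x.
Proof.
move=> yx; apply/eqP; rewrite eq_le; apply/andP; split.
  by apply: le_trans (abs_ultra x y) _; rewrite ge_max lexx ltW.
have := abs_ultra (x + y) (- y); rewrite addrK absN // le_max.
by case/orP => // xy; move: (le_lt_trans xy yx); rewrite ltxx.
Qed.

End Ultrametric.

(** * Completeness of finite-dimensional extensions *)

Section FiniteDimension.
Variables (R : realType) (F : fieldType) (K : fieldExtType F) (abs : K -> R).
Hypothesis absK : is_absval abs.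
Hypothesis F_complete : forall a : nat -> F,
  cauchy_wrt (fun x => abs x%:A) a ->
  exists x, converges_to (fun x => abs x%:A) a x.

(** The limit must lie in [V], so the notion carries closedness in [K] as well; [dist_complete_gt0]
    relies on this. *)
Definition complete_subspace (V : {vspace K}) : Prop :=
  forall u : nat -> K, (forall n, u n \in V) -> cauchy_wrt abs u ->
    exists2 x, x \in V & converges_to abs u x.

(** At distance 0, some sequence in [V] would converge to [w]; it is Cauchy, so it also has a limit
    in [V], and limits are unique. *)
Lemma dist_complete_gt0 (V : {vspace K}) (w : K) :
  complete_subspace V -> w \notin V ->
  exists2 d : R, 0 < d & forall v, v \in V -> d <= abs (w - v).
Proof.
move=> cV wV; apply: contrapT => H.
have /choice[v Hv] : forall n : nat, exists v,
    v \in V /\ abs (w - v) < n.+1%:R^-1.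
  move=> n; apply: contrapT => H'; apply: H.
  exists n.+1%:R^-1 => [|v vV]; first by rewrite invr_gt0 ltr0n.
  by rewrite leNgt; apply/negP => lt; apply: H'; exists v.
have vw : converges_to abs v w.
  move=> eps /invnS_lt[N HN]; exists N => n Nn.
  by rewrite abs_distC //; apply: lt_trans (proj2 (Hv n)) (HN n Nn).
have [x xV vx] := cV v (fun n => proj1 (Hv n)) (converges_to_cauchy absK vw).
by move: wV; rewrite (converges_to_unique absK vw vx) xV.
Qed.

(* As abs (v + a w) >= d * abs a, where d > 0 is the distance of w to V, the
   coordinate along w of a Cauchy sequence is Cauchy. *)
Lemma complete_add_line (V : {vspace K}) (w : K) :
  complete_subspace V -> complete_subspace (<[w]> + V)%VS.
Proof.
move=> cV; have [wV|wV] := boolP (w \in V).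
  by rewrite (addv_idPr _) // -memvE.
have [d d0 Hd] := dist_complete_gt0 cV wV.
move=> u uU cu.
have /choice[av Hav] : forall n, exists av : F * K,
    av.2 \in V /\ u n = av.1 *: w + av.2.
  move=> n; case/memv_addP: (uU n) => _ /vlineP[a ->] [v vV ->].
  by exists (a, v).
have bound (a : F) v : v \in V -> d * abs a%:A <= abs (a *: w + v).
  move=> vV; have [->|a0] := eqVneq a 0.
    by rewrite scale0r abs0 // mulr0 absval_ge0.
  have -> : a *: w + v = a%:A * (w - (- a^-1 *: v)).
    by rewrite mulr_algl scalerBr scalerA mulrN divff // scaleN1r opprK.
  by rewrite absvalM // mulrC ler_wpM2l ?absval_ge0 // Hd // memvZ.
have [|a Ha] := F_complete (a := fun n => (av n).1).
  move=> eps e0; have [N HN] := cu _ (mulr_gt0 d0 e0).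
  exists N => m n Nm Nn; rewrite -(ltr_pM2l d0).
  apply: le_lt_trans (HN _ _ Nm Nn); rewrite (proj2 (Hav m)) (proj2 (Hav n)).
  rewrite opprD addrACA -scalerBl; apply: bound.
  by rewrite rpredB // (proj1 (Hav _)).
have caw : converges_to abs (fun n => (av n).1 *: w) (a *: w).
  have Ha' : converges_to abs (fun n => (av n).1%:A) a%:A.
    move=> eps e0; have [N HN] := Ha eps e0.
    by exists N => n Nn; rewrite -scalerBl HN.
  move=> eps e0; have [N HN] := converges_toM absK w Ha' e0.
  by exists N => n Nn; have := HN n Nn; rewrite !mulr_algl.
(* The component in [V] is [u] minus a convergent sequence, hence Cauchy, and completeness of [V]
   applies to it. *)
have v2E : (fun n => u n - (av n).1 *: w) = (fun n => (av n).2).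
  by apply/funext => n; rewrite (proj2 (Hav n)) addrC addKr.
have [|x xV Hx] := cV _ (fun n => proj1 (Hav n)).
  by rewrite -v2E; apply: cauchyB => //; apply: converges_to_cauchy caw.
exists (a *: w + x); first by rewrite memv_add // memvZ // memv_line.
have := converges_toD absK caw Hx.
by congr converges_to; apply/funext => n; rewrite (proj2 (Hav n)).
Qed.

(** Induction on a spanning list, starting from the zero space, then applied to a basis of [K]. *)
Lemma complete_fullv : complete_subspace fullv.
Proof.
have cX (X : seq K) : complete_subspace <<X>>%VS.
  elim: X => [|w X IH]; last by rewrite span_cons; apply: complete_add_line.
  rewrite span_nil => u u0 _; exists 0; first exact: mem0v.
  move=> eps e0; exists 0%N => n _.
  by have := u0 n; rewrite memv0 => /eqP->; rewrite subr0 abs0.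
by rewrite -(span_basis (vbasisP fullv)).
Qed.

End FiniteDimension.

(** * The absolute value on [Qp p], its discreteness and completeness *)

Section QpAbs.
Variables (R : realType) (p : nat).
Local Notation rabs := (fun x : rat => ratr (padic_abs p x) : R).

Lemma padic_absval : is_absval rabs.
Proof.
split=> [x|x|x y|x y].
- by rewrite ler0q padic_abs_ge0.
- split=> [/eqP|->]; last by rewrite padic_abs0 rmorph0.
  by rewrite fmorph_eq0 padic_abs_eq0 => /eqP.
- by rewrite padic_absM rmorphM.
- rewrite -rmorphD ler_rat; apply: le_trans (padic_absD p x y) _.
  by rewrite ge_max lerDl lerDr !padic_abs_ge0.
Qed.

Lemma padic_abs_nat (n : nat) : padic_abs p n%:R <= 1.
Proof.
elim: n => [|n IH]; first by rewrite padic_abs0 ler01.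
rewrite -natr1; apply: le_trans (padic_absD _ _ _) _.
by rewrite ge_max IH padic_abs1 lexx.
Qed.

(** This is [abs_ultra_lt] for rationals, transported along [ratr], which is injective and preserves
    order. *)
Lemma padic_abs_near (x y : rat) :
  padic_abs p (x - y) < padic_abs p y -> padic_abs p x = padic_abs p y.
Proof.
move=> xy; apply: (fmorph_inj (ratr : rat -> R)).
rewrite -[x in LHS](subrK y) addrC; apply: (abs_ultra_lt padic_absval).
  by move=> n; rewrite -(rmorph1 (ratr : rat -> R)) ler_rat padic_abs_nat.
by rewrite ltr_rat.
Qed.

Lemma Qp_piB (u v : cauchy_seq p) :
  \pi_(Qp p)%qT u - \pi_(Qp p)%qT v = \pi_(Qp p)%qT (u - v).
Proof. by rewrite !piE. Qed.

Lemma Qp_piD (u v : cauchy_seq p) :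
  \pi_(Qp p)%qT u + \pi_(Qp p)%qT v = \pi_(Qp p)%qT (u + v).
Proof. by rewrite !piE. Qed.

Lemma Qp_piM (u v : cauchy_seq p) :
  \pi_(Qp p)%qT u * \pi_(Qp p)%qT v = \pi_(Qp p)%qT (u * v).
Proof. by rewrite !piE. Qed.

(** The chosen representative of 0 is only known to be a null sequence, so this limit is computed
    directly. *)
Lemma Qp_abs0 : Qp_abs R (0 : Qp p) = 0.
Proof.
have /asboolP n0 : repr (0 : Qp p) \in @padic_null p by rewrite -Qp_eq0 reprK.
apply: cvg_lim => //; apply/cvgrPdist_lt => eps e0.
have [k Hk] := invnS_lt e0.
have [|N HN] := n0 k.+1%:R^-1; first by rewrite invr_gt0 ltr0n.
exists N => // n /= Nn; rewrite sub0r normrN ger0_norm ?ler0q ?padic_abs_ge0 //.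
apply: lt_trans (_ : ratr k.+1%:R^-1 < _); first by rewrite ltr_rat HN.
by rewrite fmorphV rmorph_nat Hk.
Qed.

(** Off the zero class the limit defining [Qp_abs] is an eventually constant value, and it can be
    read on any representative. The later facts on [Qp_abs] reduce to rationals in this way. *)
Lemma Qp_abs_eventually (u : cauchy_seq p) : \pi_(Qp p)%qT u != 0 ->
  exists N : nat, forall n : nat, (N <= n)%N ->
    ratr (padic_abs p (u n)) = Qp_abs R (\pi_(Qp p)%qT u).
Proof.
rewrite Qp_eq0 => /padic_nonnull[N1 [d d0 Hd]].
have /asboolP/(_ _ d0)[N2 HN2] := valP u.
set v := repr (\pi_(Qp p)%qT u).
have /asboolP/(_ _ d0)[N3 HN3] : v - u \in @padic_null p.
  by rewrite -Qp_eq0 -Qp_piB reprK subrr.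
(* Beyond [N] the values of [u] are at least [d], while both the oscillation of [u] and its
   difference to [v] are below [d]; [padic_abs_near] then freezes both absolute values. *)
pose N := maxn N1 (maxn N2 N3).
have uE n : (N <= n)%N -> padic_abs p (u n) = padic_abs p (u N).
  rewrite !geq_max => /andP[n1 /andP[n2 n3]]; apply: padic_abs_near.
  apply: lt_le_trans (Hd N _); last by rewrite leq_maxl.
  by apply: HN2 => //; rewrite !leq_max leqnn !orbT.
have vE n : (N <= n)%N -> padic_abs p (v n) = padic_abs p (u N).
  move=> Nn; rewrite -(uE n Nn); move: Nn.
  rewrite !geq_max => /andP[n1 /andP[n2 n3]]; apply: padic_abs_near.
  exact: lt_le_trans (HN3 n n3) (Hd n n1).
exists N => n Nn; rewrite uE //; apply/esym/cvg_lim => //.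
by apply: cvg_near_cst; exists N => // k /= Nk; rewrite -/v vE.
Qed.

(** Upper bounds pass to the class even when it is zero, where the values need not become
    constant. *)
Lemma Qp_abs_pi_le (u : cauchy_seq p) (b : R) (N : nat) : 0 <= b ->
  (forall n, (N <= n)%N -> ratr (padic_abs p (u n)) <= b) ->
  Qp_abs R (\pi_(Qp p)%qT u) <= b.
Proof.
move=> b0 Hb; have [->|/Qp_abs_eventually[M HM]] := eqVneq (\pi_(Qp p)%qT u) 0.
  by rewrite Qp_abs0.
by rewrite -(HM (maxn N M)) ?Hb ?leq_maxl ?leq_maxr.
Qed.

Lemma Qp_absval : is_absval (@Qp_abs R p).
Proof.
have ge0 (x : Qp p) : 0 <= Qp_abs R x.
  rewrite -[x]reprK.
  have [->|/Qp_abs_eventually[N HN]] := eqVneq (\pi_(Qp p)%qT (repr x)) 0.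
    by rewrite Qp_abs0.
  by rewrite -(HN N) // ler0q padic_abs_ge0.
split=> // [x|x y|x y].
- split=> [|->]; last exact: Qp_abs0.
  move=> x0; apply/eqP; move: x0; rewrite -[x]reprK; apply: contra_eqT => nx.
  have [N HN] := Qp_abs_eventually nx.
  move: nx; rewrite Qp_eq0 => /padic_nonnull[M [d d0 Hd]].
  rewrite -(HN (maxn N M)) ?leq_maxl // fmorph_eq0 gt_eqF //.
  by rewrite (lt_le_trans d0) // Hd // leq_maxr.
- have [->|x0] := eqVneq x 0; first by rewrite mul0r Qp_abs0 mul0r.
  have [->|y0] := eqVneq y 0; first by rewrite mulr0 Qp_abs0 mulr0.
  have := mulf_neq0 x0 y0; move: x0 y0; rewrite -[x]reprK -[y]reprK Qp_piM.
  move=> /Qp_abs_eventually[N HN] /Qp_abs_eventually[M HM].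
  move=> /Qp_abs_eventually[L HL]; pose n := maxn N (maxn M L).
  rewrite -(HN n) -?(HM n) -?(HL n) ?leq_max ?leqnn ?orbT //.
  by rewrite -rmorphM -padic_absM.
- have [->|x0] := eqVneq x 0; first by rewrite add0r Qp_abs0 add0r.
  have [->|y0] := eqVneq y 0; first by rewrite addr0 Qp_abs0 addr0.
  move: x0 y0; rewrite -[x]reprK -[y]reprK Qp_piD.
  move=> /Qp_abs_eventually[N HN] /Qp_abs_eventually[M HM].
  (* The sum may be the zero class, so only an upper bound is taken for it. *)
  apply: (@Qp_abs_pi_le _ _ (maxn N M)) => [|n]; first by rewrite addr_ge0.
  rewrite geq_max => /andP[Nn Mn]; rewrite -(HN n) // -(HM n) //.
  exact: (absvalD padic_absval).
Qed.

Lemma padic_const_subproof (q : rat) : (fun=> q) \in padic_cauchy p.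
Proof.
by apply/asboolP => eps e0; exists 0%N => m n _ _; rewrite subrr padic_abs0.
Qed.

Definition padic_const (q : rat) : cauchy_seq p :=
  CauchySeq (padic_const_subproof q).

Lemma Qp_abs_const (q : rat) :
  Qp_abs R (\pi_(Qp p)%qT (padic_const q)) = ratr (padic_abs p q).
Proof.
have [q0|/Qp_abs_eventually[N HN]] := eqVneq (\pi_(Qp p)%qT (padic_const q)) 0.
  move/eqP: (q0); rewrite Qp_eq0 => /asboolP Hq; rewrite q0 Qp_abs0.
  have [->|q1] := eqVneq q 0; first by rewrite padic_abs0 rmorph0.
  (* For [q] nonzero, nullity of the constant sequence at [eps] equal to [padic_abs p q] would make
     this number smaller than itself. *)
  have [|N /(_ N (leqnn N))] := Hq (padic_abs p q).
    by rewrite lt_neqAle padic_abs_ge0 eq_sym padic_abs_eq0 q1.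
  by rewrite ltxx.
by rewrite -(HN N).
Qed.

Lemma Qp_abs_nat (n : nat) : Qp_abs R (n%:R : Qp p) <= 1.
Proof.
have -> : n%:R = \pi_(Qp p)%qT (n%:R : cauchy_seq p) by rewrite rmorph_nat.
apply: (@Qp_abs_pi_le _ _ 0%N) => // k _; rewrite -(rmorph1 (ratr : rat -> R)) ler_rat.
suff -> : (n%:R : cauchy_seq p) k = n%:R by apply: padic_abs_nat.
elim: n => // n IH; rewrite -!natr1 -IH //.
Qed.

(** For [p] prime the nonzero values are powers of [p], so one above 1 is at least [p]; otherwise
    the only nonzero value is 1. *)
Lemma padic_abs_gt1 (x : rat) : 1 < padic_abs p x -> 2 <= padic_abs p x.
Proof.
rewrite /padic_abs; case: eqP => // x0.
have [pp|np] := boolP (prime p); last first.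
  have log0 k : logn p k = 0%N by rewrite lognE (negPf np).
  by rewrite !log0 subrr expr0z ltxx.
set z := (_ - _)%R.
have p1 : 1 < p%:Q by rewrite ltr1n prime_gt1.
case: z => [[|n]|n]; first by rewrite expr0z ltxx.
  move=> _; rewrite -exprnP exprS; apply: le_trans (_ : p%:Q <= _).
    by rewrite ler_nat prime_gt1.
  by rewrite ler_peMr ?exprn_ege1 // ltW // (lt_trans ltr01).
rewrite NegzE -exprnN invf_gt1 ?exprn_gt0 ?(lt_trans ltr01) // => h.
by move: (lt_le_trans h (exprn_ege1 n.+1 (ltW p1))); rewrite ltxx.
Qed.

Lemma Qp_abs_gt1 (x : Qp p) : 1 < Qp_abs R x -> 2 <= Qp_abs R x.
Proof.
have [->|] := eqVneq x 0; first by rewrite Qp_abs0 ltr10.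
rewrite -[x]reprK => /Qp_abs_eventually[N HN]; rewrite -(HN N) //.
have := @padic_abs_gt1 (repr x N).
by rewrite -(ltr_rat R) -(ler_rat R) rmorph1 rmorph_nat.
Qed.

(** The witness is a term of the representative, taken so far out that all later terms lie within
    [eps] of it. *)
Lemma Qp_approx (x : Qp p) (eps : rat) : 0 < eps ->
  exists q : rat, Qp_abs R (x - \pi_(Qp p)%qT (padic_const q)) <= ratr eps.
Proof.
move=> e0; have /asboolP/(_ _ e0)[N HN] := valP (repr x).
exists (repr x N); rewrite -{1}[x]reprK Qp_piB.
apply: (@Qp_abs_pi_le _ _ N) => [|n Nn]; first by rewrite ler0q ltW.
by rewrite ler_rat ltW // HN.
Qed.

(** Each [a n] is replaced by a rational [q n] at distance at most [1 / (n + 1)]. The sequence [q]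
    is then itself a p-adic Cauchy sequence, and its class is the limit. *)
Lemma Qp_complete (a : nat -> Qp p) :
  cauchy_wrt (@Qp_abs R p) a -> exists x, converges_to (@Qp_abs R p) a x.
Proof.
move=> ca; have absQ := Qp_absval.
have /choice[q Hq] : forall n : nat, exists q : rat,
    Qp_abs R (a n - \pi_(Qp p)%qT (padic_const q)) <= n.+1%:R^-1.
  move=> n; have [|q] := Qp_approx (a n) (eps := n.+1%:R^-1).
    by rewrite invr_gt0 ltr0n.
  by rewrite fmorphV rmorph_nat; exists q.
pose i n := \pi_(Qp p)%qT (padic_const (q n)).
have ci : cauchy_wrt (@Qp_abs R p) i.
  (* [i] is the Cauchy sequence [a] minus a sequence tending to 0. *)
  have -> : i = fun n => a n - (a n - i n) by apply/funext => n; rewrite subKr.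
  apply: cauchyB => //; apply: (@converges_to_cauchy _ _ _ absQ _ 0) => eps e0.
  have [k Hk] := invnS_lt e0; exists k => n kn; rewrite subr0.
  exact: le_lt_trans (Hq n) (Hk n kn).
have qE m n : Qp_abs R (i m - i n) = ratr (padic_abs p (q m - q n)).
  rewrite -Qp_abs_const /i Qp_piB; congr (Qp_abs R (\pi_(Qp p)%qT _)).
  exact/val_inj.
have cq : q \in padic_cauchy p.
  apply/asboolP => eps e0; have [|N HN] := ci (ratr eps); first by rewrite ltr0q.
  by exists N => m n Nm Nn; rewrite -(ltr_rat R) -qE HN.
have ix : converges_to (@Qp_abs R p) i (\pi_(Qp p)%qT (CauchySeq cq)).
  move=> eps e0; have e2 : 0 < eps / 2 by rewrite divr_gt0.
  have [N HN] := ci _ e2; exists N => n Nn.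
  (* [Qp_abs_pi_le] yields only a weak inequality; halving [eps] restores the strict one. *)
  apply: le_lt_trans (_ : eps / 2 < _); last first.
    by rewrite ltr_pdivrMr // ltr_pMr // ltr1n.
  rewrite /i Qp_piB; apply: (@Qp_abs_pi_le _ _ N) => [|m Nm]; first exact: ltW.
  by have := HN n m Nn Nm; rewrite qE => /ltW.
(* The summand 0 is the limit of [a n - i n], in the form that [converges_toD] expects. *)
exists (0 + \pi_(Qp p)%qT (CauchySeq cq)).
have -> : a = fun n => (a n - i n) + i n by apply/funext => n; rewrite subrK.
apply: (converges_toD absQ) => // eps e0.
have [k Hk] := invnS_lt e0; exists k => n kn; rewrite subr0.
exact: le_lt_trans (Hq n) (Hk n kn).
Qed.

End QpAbs.

(** * Ramification and the gap above 1 in the value group *)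

(** Pigeonhole: among the [e + 1] powers $v^0, \dots, v^e$ two share a coset of the base value
    group. Their quotient is a base value above 1, hence at least [b], and it is a power of [v] with
    exponent at most [e]. *)
Lemma value_group_gap (R : realType) (F : fieldType) (K : fieldExtType F)
    (abs : K -> R) (absK : is_absval abs) (U : {subfield K}) (e : nat) (b v : R) :
  (forall a : F, 1 < abs a%:A -> b <= abs a%:A) ->
  ramification_index abs U e -> value_group abs U v -> 1 < v -> b <= v ^+ e.
Proof.
move=> F_gap [r [rU Hr]] [x [xU x0] <-{v}] x1.
have /choice[i Hi] : forall k : 'I_e.+1, exists i : 'I_e,
    value_group abs 1%VS (abs x ^+ k / r i).
  move=> k; have [|i [Hi _]] := Hr (abs x ^+ k); last by exists i.
  by exists (x ^+ k); [rewrite /= rpredX // expf_neq0|rewrite absX].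
have /injectivePn[k [l kl ikl]] : ~~ injectiveb i.
  apply/injectiveP => /leq_card; by rewrite !card_ord ltnn.
wlog lt_kl : k l kl ikl / (k < l)%N.
  move=> H; have [lt|lt|eq] := ltngtP k l; first exact: (H k l).
    by apply: (H l k) => //; rewrite eq_sym.
  by rewrite (val_inj eq) eqxx in kl.
have [w [_ w0] wE] := rU (i k).
have r0 : r (i k) != 0 by rewrite -wE (abs_eq0 absK).
have [y [/vlineP[a ->] y0] yE] := Hi k.
have [z [/vlineP[a' ->] z0] zE] := Hi l; rewrite -ikl in zE.
have x0' : abs x != 0 by rewrite abs_eq0.
(* The common coset representative [r (i k)] cancels in the quotient. *)
have xE : abs x ^+ (l - k) = abs (a' / a)%:A.
  have -> : (a' / a)%:A = a'%:A / a%:A :> K by rewrite -!in_algE fmorph_div.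
  rewrite (absvalM absK) (absV absK) yE zE invf_div mulrA divfK //.
  by rewrite -expfB_cond ?(negPf x0') //= ltnW.
apply: le_trans (_ : abs x ^+ (l - k) <= _).
  by rewrite xE F_gap // -xE exprn_egt1 // subn_eq0 -ltnNge.
by rewrite ler_weXn2l ?(ltW x1) // leq_subLR (leq_trans (leq_ord l)) // leq_addl.
Qed.

(** * Algebra of the convergents *)

Section Convergents.
Variable K : fieldType.
Implicit Types c : nat -> K.

Lemma cf_numSS c n : cf_num c n.+2 = c n.+2 * cf_num c n.+1 + cf_num c n.
Proof. by []. Qed.

Lemma cf_denSS c n : cf_den c n.+2 = c n.+2 * cf_den c n.+1 + cf_den c n.
Proof. by []. Qed.

(** [cfrac] recurses from the front and the recurrences from the back; this relation to the tail of
    [c] reconciles them. The two-step recurrence calls for strong induction. *)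
Lemma cf_shift c n :
  cf_num c n.+1 = c 0%N * cf_num (fun j => c j.+1) n + cf_den (fun j => c j.+1) n
  /\ cf_den c n.+1 = cf_num (fun j => c j.+1) n.
Proof.
elim/ltn_ind: n => -[|[|n]] IH; [by []|by split=> /=; ring|].
have [E1 E2] := IH n.+1 (ltnSn _); have [E3 E4] := IH n (ltnW (ltnSn _)).
rewrite (cf_numSS c) (cf_denSS c) E1 E2 E3 E4 cf_numSS cf_denSS.
by split=> //; ring.
Qed.

Lemma cf_det c n :
  cf_num c n.+1 * cf_den c n - cf_num c n * cf_den c n.+1 = (-1) ^+ n.
Proof.
elim: n => [|n IH]; first by rewrite /= expr0; ring.
by rewrite cf_numSS cf_denSS exprS -IH; ring.
Qed.

(** The induction passes to tails of [c], hence the hypothesis on every shift [i]. With [0^-1 = 0],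
    it keeps the inversions in [cfrac] genuine: the denominator of [c] is the numerator of its
    tail. *)
Lemma cfracE c : (forall i n, cf_den (fun j => c (i + j)%N) n != 0) ->
  forall n, cfrac c n = cf_num c n / cf_den c n.
Proof.
move=> c0 n; elim: n c c0 => [|n IH] c c0; first by rewrite /= divr1.
have [-> dE] := cf_shift c n; have := c0 0%N n.+1; have := c0 1%N n.
rewrite -[cfrac _ _]/(c 0%N + (cfrac (fun j => c j.+1) n)^-1) IH; last first.
  move=> i k; exact: c0 i.+1 k.
rewrite -[cf_den _ n.+1]/(cf_den c n.+1) dE => d0 n0.
by rewrite mulrDl mulfK // invf_div.
Qed.

End Convergents.

(** * Growth of the denominators and the exact error *)

Section Convergence.
Variables (R : realType) (K : fieldType) (abs : K -> R).
Hypothesis absK : is_absval abs.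
Hypothesis abs_nat : forall n : nat, abs n%:R <= 1.

(** In the recurrence $c_n t_{n-1}$ strictly dominates $t_{n-2}$. Positivity is proved jointly,
    since it is what makes the growth strict. *)
Lemma abs_cf_denS (c : nat -> K) (n : nat) :
  (forall j, (1 <= j)%N -> 1 < abs (c j)) ->
  0 < abs (cf_den c n) /\ abs (cf_den c n.+1) = abs (c n.+1) * abs (cf_den c n).
Proof.
move=> c1; elim: n => [|n [pos IH]]; first by rewrite /= abs1 // mulr1 ltr01.
have lt : abs (cf_den c n) < abs (cf_den c n.+1) by rewrite IH ltr_pMl // c1.
have pos' := lt_trans pos lt; split=> //.
rewrite cf_denSS abs_ultra_lt // (absvalM absK) //.
by apply: lt_trans lt _; rewrite ltr_pMl // c1.
Qed.

(** The bound [b] keeps the $|c_j|$ uniformly away from 1, which forces the denominators to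
    infinity; placing the exponent [e] on $|c_j|$ avoids roots of [b]. *)
Lemma cf_convergence (c : nat -> K) (b : R) (e : nat) :
  1 < b -> (forall j, (1 <= j)%N -> 1 < abs (c j) /\ b <= abs (c j) ^+ e) ->
  (forall u, cauchy_wrt abs u -> exists x, converges_to abs u x) ->
  exists alpha, converges_to abs (fun n => cf_num c n / cf_den c n) alpha /\
    forall n, abs (alpha - cf_num c n / cf_den c n) =
              (abs (cf_den c n) * abs (cf_den c n.+1))^-1.
Proof.
move=> b1 Hc K_complete; have c1 j : (1 <= j)%N -> 1 < abs (c j).
  by move=> /Hc[].
have cb j : (1 <= j)%N -> b <= abs (c j) ^+ e by move=> /Hc[].
set x := fun n => cf_num c n / cf_den c n.
have t0 n : 0 < abs (cf_den c n) by have [] := abs_cf_denS n c1.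
have tS n : abs (cf_den c n.+1) = abs (c n.+1) * abs (cf_den c n).
  by have [] := abs_cf_denS n c1.
have t1 n : abs (cf_den c n) < abs (cf_den c n.+1).
  by rewrite tS ltr_pMl // c1.
pose d n := (abs (cf_den c n) * abs (cf_den c n.+1))^-1.
have xS n : abs (x n.+1 - x n) = d n.
  have nz k : cf_den c k != 0 by rewrite -(abs_gt0 absK).
  have -> : x n.+1 - x n = (-1) ^+ n / (cf_den c n * cf_den c n.+1).
    by rewrite -(cf_det c n) /x; field; rewrite !nz.
  by rewrite (absvalM absK) (absV absK) (absX absK) (absN absK) (abs1 absK)
     expr1n mul1r (absvalM absK).
have dS n : d n.+1 < d n.
  rewrite ltf_pV2 ?posrE ?mulr_gt0 // mulrC ltr_pM2l //.
  exact: lt_trans (t1 n) (t1 n.+1).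
have d_le m n : (n <= m)%N -> d m <= d n.
  move=> nm; rewrite -(subnK nm); elim: (m - n)%N => // k IH.
  by rewrite addSn (le_trans _ IH) // ltW.
(* In the ultrametric setting the telescoping sum is bounded by its largest term, the first one. *)
have xd m n : (n <= m)%N -> abs (x m - x n) <= d n.
  move=> nm; rewrite -(subnK nm); elim: (m - n)%N => [|k IH].
    by rewrite subrr (abs0 absK) invr_ge0 ltW // mulr_gt0.
  rewrite (_ : _ - _ = (x (k + n).+1 - x (k + n)%N) + (x (k + n)%N - x n)).
    apply: le_trans (abs_ultra absK abs_nat _ _) _.
    by rewrite ge_max xS IH d_le // leq_addl.
  by rewrite addSn; ring.
have tb n : b ^+ n <= abs (cf_den c n) ^+ e.
  elim: n => [|n IH]; first by rewrite /= (abs1 absK) expr1n expr0.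
  rewrite tS exprMn exprS ler_pM ?exprn_ge0 ?cb //; exact: ltW (lt_trans ltr01 b1).
have d0 (eps : R) : 0 < eps -> exists N, forall n, (N <= n)%N -> d n < eps.
  move=> e0; apply: contrapT => H.
  (* Otherwise the abs (cf_den c n) stay below 1 / eps, against tb. *)
  have dge n : eps <= d n.
    rewrite leNgt; apply/negP => lt; apply: H; exists n => m nm.
    exact: le_lt_trans (d_le _ _ nm) lt.
  have tle n : abs (cf_den c n) <= eps^-1.
    rewrite -[leLHS]invrK lef_pV2 ?posrE ?invr_gt0 //.
    apply: le_trans (dge n) _; rewrite lef_pV2 ?posrE ?mulr_gt0 //.
    rewrite ler_peMr ?(ltW (t0 _)) // tS mulr_ege1 ?(ltW (c1 _ _)) //.
    elim: n => [|n IH]; first by rewrite /= (abs1 absK).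
    exact: le_trans IH (ltW (t1 n)).
  set M := eps^-1 ^+ e.
  have bM n : b ^+ n <= M.
    by apply: le_trans (tb n) _; rewrite lerXn2r ?nnegrE ?invr_ge0 ?(ltW (t0 _)) ?(ltW e0).
  by have := bounded_expr_le1 bM; rewrite leNgt b1.
have cx : cauchy_wrt abs x.
  move=> eps e0; have [N HN] := d0 _ (divr_gt0 e0 (ltr0Sn R 1)).
  exists N => m n Nm Nn; rewrite (_ : _ - _ = (x m - x N) + (x N - x n)); last by ring.
  apply: le_lt_trans (absvalD absK _ _) _; rewrite [eps]splitr ltrD //.
    exact: le_lt_trans (xd _ _ Nm) (HN _ _).
  by rewrite (abs_distC absK); exact: le_lt_trans (xd _ _ Nn) (HN _ _).
have [alpha Ha] := K_complete x cx; exists alpha; split=> // n.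
(* The tolerance is [d n.+1] itself: a far convergent [x m] is that close to [alpha], and [xd]
   bounds its distance to [x n.+1]. *)
have aSn : abs (alpha - x n.+1) <= d n.+1.
  have [|N HN] := Ha (d n.+1); first by rewrite invr_gt0 mulr_gt0.
  pose m := maxn N n.+1.
  rewrite (_ : _ - _ = (alpha - x m) + (x m - x n.+1)); last by ring.
  apply: le_trans (abs_ultra absK abs_nat _ _) _; rewrite ge_max.
  by rewrite (abs_distC absK) ltW ?HN ?xd ?leq_maxl ?leq_maxr.
(* Splitting at [n.+1] leaves one summand of absolute value exactly [d n] and one of at most
   [d n.+1 < d n], so the sum has absolute value [d n]. *)
rewrite -[RHS]xS (_ : _ - _ = (x n.+1 - x n) + (alpha - x n.+1)); last first.
  by rewrite /x; ring.
apply: (abs_ultra_lt absK abs_nat); rewrite xS; exact: le_lt_trans aSn (dS n).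
Qed.

End Convergence.

(** * Continued fractions over a finite extension of $\mathbb{Q}_p$ *)

Theorem lemma8 (R : realType) (p : nat) (p_prime : prime p)
  (K : fieldExtType (Qp p)) (m e f : nat) (K_deg : \dim {:K} = m)
  (abs : K -> R) (abs_absval : is_absval abs)
  (abs_ext : forall x : Qp p, abs x%:A = Qp_abs R x)
  (K_ram : ramification_index abs {:K}%AS e)
  (K_res : residue_degree abs {:K}%AS f)
  (L : {subfield K}) (L_deg : \dim L = f) (L_unram : unramified abs L)
  (gamma : K) (gamma_prim : (p ^ f - 1).-primitive_root gamma)
  (L_gen : <<1%VS; gamma>>%VS = L)
  (beta : K) (K_gen : <<L; beta>>%VS = fullv)
  (beta_abs : abs beta = p%:R `^ (e%:R^-1))
  (D : set int)
  (D_digits : D = std_digits p \/ odd p /\ D = sym_digits p)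
  (c : nat -> K) (c0 : Zset p e f D gamma beta (c 0%N))
  (cS : forall j : nat, (1 <= j)%N -> Zstar abs p e f D gamma beta (c j)) :
  (forall n : nat,
     cf_den c n != 0 /\ cf_num c n / cf_den c n = cfrac c n) /\
  exists alpha : K,
    ((fun n : nat => abs (alpha - cf_num c n / cf_den c n)) @ \oo --> (0 : R))
    /\ forall n : nat,
         abs (alpha - cf_num c n / cf_den c n) =
         1 / (abs (cf_den c n) * abs (cf_den c n.+1)).
Proof.

have abs_nat (n : nat) : abs n%:R <= 1.
  by rewrite -(rmorph_nat (in_alg K)) /= abs_ext Qp_abs_nat.
have abs_gap (a : Qp p) : 1 < abs a%:A -> 2 <= abs a%:A.
  by rewrite abs_ext; apply: Qp_abs_gt1.
(* Values of the base field above 1 are at least 2, so [value_group_gap] applies with [b] equal to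
   2. *)
have c_gap j : (1 <= j)%N -> 1 < abs (c j) /\ 2 <= abs (c j) ^+ e.
  move=> /cS[_ cj1]; split=> //.
  apply: (value_group_gap abs_absval abs_gap K_ram) => //.
  by exists (c j) => //=; rewrite memvf -(abs_gt0 abs_absval) (lt_trans ltr01).
have Qp_complete_alg (a : nat -> Qp p) : cauchy_wrt (fun x => abs x%:A) a ->
    exists x, converges_to (fun x => abs x%:A) a x.
  have -> : (fun x : Qp p => abs x%:A) = @Qp_abs R p by apply/funext.
  exact: Qp_complete.
have K_complete u : cauchy_wrt abs u -> exists x, converges_to abs u x.
  move=> cu; have [x _ ux] :=
    complete_fullv abs_absval Qp_complete_alg (fun n => memvf (u n)) cu.
  by exists x.
(* Every tail of [c] again has its entries of positive index above 1 in absolute value. *)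
have den0 i n : cf_den (fun j => c (i + j)%N) n != 0.
  rewrite -(abs_gt0 abs_absval); apply: (proj1 (abs_cf_denS abs_absval abs_nat n _)).
  by move=> j j1; apply: (proj1 (c_gap _ _)); rewrite addn_gt0 j1 orbT.
split=> [n|]; first by rewrite (cfracE den0); split=> //; apply: den0 0%N n.
have [|alpha [Ha aE]] := cf_convergence abs_absval abs_nat _ c_gap K_complete.
  by rewrite ltr1n.
exists alpha; split=> [|n]; last by rewrite aE div1r.
apply/cvgrPdist_lt => eps e0; have [N HN] := Ha eps e0.
exists N => // n /= Nn; rewrite sub0r normrN ger0_norm ?(absval_ge0 abs_absval) //.
by rewrite (abs_distC abs_absval) HN.
Qed.
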